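(* Let $X$ be a Banach space and assume that $A\subseteq X$ is bounded and convex, and let $a\in A$. Then the following conditions are equivalent: (i) $a\in\mathrm{SCD}(A)$; (ii) there exists a sequence of (non-empty) relatively weakly open subsets of $A$ which is determining for $a$; (iii) there exists a sequence of convex combinations of slices of $A$ which is determining for $a$.
   Context: Banach spaces are over $\mathbb{K}=\mathbb{R}$ or $\mathbb{C}$; $X^*$ denotes the topological dual of $X$. A slice of a bounded set $A\subseteq X$ is a non-empty intersection of $A$ with an open half-space; it can be written as $S(A,x^*,\alpha)=\{x\in A:\operatorname{Re}x^*(x)>\sup_{b\in A}\operatorname{Re}x^*(b)-\alpha\}$ with $x^*\in X^*$, $\alpha>0$. A convex combination of slices of $A$ is a set of the form $\sum_{i=1}^n\lambda_iS_i$, where $n\in\mathbb{N}$, $S_1,\dots,S_n$ are slices of $A$, $\lambda_i\ge0$ and $\sum_{i=1}^n\lambda_i=1$. Let $A\subseteq X$ be bounded and convex and $a\in A$. A countable collection $\{V_n:n\in\mathbb{N}\}$ of non-empty subsets of $A$ is determining for $a$ if $a\in\overline{\mathrm{conv}}(B)$ whenever $B\subseteq A$ intersects all the sets $V_n$. The point $a$ is an SCD point (slicely countably determined point) of $A$ if there is a sequence of slices of $A$ that is determining for $a$; $\mathrm{SCD}(A)$ is the set of all SCD points of $A$. *)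

(* Defs.v *)
From HB Require Import structures.
From mathcomp Require Import all_boot all_order all_algebra.
From mathcomp Require Import all_classical all_reals all_analysis.
From mathcomp Require Import complex.

Set Implicit Arguments.
Unset Strict Implicit.
Unset Printing Implicit Defensive.

Import Order.TTheory GRing.Theory Num.Theory.
Import numFieldNormedType.Exports.

Local Open Scope classical_set_scope.
Local Open Scope ring_scope.

Variant scalars := RealScalars | ComplexScalars.

Definition scalar_field (R : realType) (k : scalars) : numFieldType :=
  match k with
  | RealScalars => R
  | ComplexScalars => R[i]
  end.

Definition scalar_re (R : realType) (k : scalars) : scalar_field R k -> R :=
  match k return scalar_field R k -> R with
  | RealScalars => fun x => x
  | ComplexScalars => fun z => complex.Re z
  end.

Section SCD.
Variables (R : realType) (k : scalars).
Let K := scalar_field R k.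
Variable X : normedModType K.
Implicit Types (A B S : set X) (a : X) (V : nat -> set X).

Definition topological_dual := {f : {linear X -> K^o} | continuous f}.

Definition topological_dual_fun (f : topological_dual) : X -> K^o := sval f.
Coercion topological_dual_fun : topological_dual >-> Funclass.

(* The supremum of the initial topologies of the functionals of the dual, that
   is, the coarsest topology on X making all of them continuous. *)
Definition weak_topology : Type :=
  sup_topology (fun f : topological_dual =>
    Topological.class (initial_topology f)).

HB.instance Definition _ := Topological.on weak_topology.

Definition relatively_weakly_open A S :=
  exists2 U : set weak_topology, open U & S = A `&` U.

(* For f = 0 and A non-empty this is A itself. For bounded A the supremum is a
   genuine one. *)
Definition slice A (f : topological_dual) (alpha : R) : set X :=
  [set x | A x /\
    sup [set scalar_re (f b) | b in A] - alpha < scalar_re (f x)].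

Definition is_slice A S :=
  S !=set0 /\ exists f alpha, 0 < alpha /\ S = slice A f alpha.

(* The weights live in K; in the complex case 0 <= lambda i forces lambda i to
   be real. *)
Definition is_convex_comb_of_slices A S :=
  exists (n : nat) (lambda : 'I_n -> K) (T : 'I_n -> set X),
    [/\ forall i, 0 <= lambda i, \sum_i lambda i = 1,
        forall i, is_slice A (T i) &
        S = [set x | exists2 t : 'I_n -> X,
               (forall i, T i (t i)) & x = \sum_i lambda i *: t i]].

Definition convex_hull B : set X := smallest (@convex_set K X) B.

Definition determining A a V :=
  (forall n, V n !=set0 /\ V n `<=` A) /\
  forall B, B `<=` A -> (forall n, B `&` V n !=set0) -> closure (convex_hull B) a.

Definition SCD A : set X :=
  [set a | A a /\
    exists V, (forall n, is_slice A (V n)) /\ determining A a V].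

End SCD.

(* Main.v *)
Require Import Defs.
From mathcomp Require Import all_boot all_order all_algebra.
From mathcomp Require Import all_classical all_reals all_analysis.
From mathcomp Require Import complex.
From mathcomp Require Import ring lra.

(** The three conditions are linked by two facts about replacing the members of
a determining sequence.

Shrinking the members keeps a sequence determining ([determining_shrink]), since
a set that meets the smaller sets meets the larger ones.  Slices are relatively
weakly open, and by Bourgain's lemma every non-empty relatively weakly open
subset of A contains a convex combination of slices ([bourgain]); this gives
(i) => (ii) => (iii).

For (iii) => (i), list all the slices that occur in the countably many convex
combinations.  If B meets each of these slices, then conv(B) meets each of the
convex combinations, so a lies in the closure of conv(conv(B)) = conv(B)
([determining_slices]).

Bourgain's lemma is usually deduced from the Krein-Milman theorem in the bidual.
The proof below uses no compactness.  A basic weak neighbourhood of x0 is a ball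
for a Euclidean semi-norm q, where q(x)^2 is a finite sum of squares of real
functionals ([weak_nbhs_sip]).  Let C be the convex set of those c in A such
that some convex combination of slices lies in a small q-ball around c.  For
any z, a point y of A nearly farthest from z lies in C: the ball around z that
just contains A is so curved that the slice of A cut off near y in the direction
y - z is small ([far_point_slice]).  If x0 were at a positive q-distance from C,
some ball, centred far away on the side of C opposite to x0, would contain C and
miss x0 by a definite amount ([separating_ball]); but C contains points whose
distance to the centre is nearly as large as that of any point of A, x0 included.
So some c in C is q-close to x0, and the convex combination of slices attached
to c lies in the prescribed neighbourhood. *)

Import Order.TTheory GRing.Theory Num.Theory.
Import numFieldNormedType.Exports.

Local Open Scope classical_set_scope.
Local Open Scope ring_scope.

Set Implicit Arguments.
Unset Strict Implicit.
Unset Printing Implicit Defensive.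

(** * The real part and real scalars *)

Definition real_scalar (R : realType) (k : scalars) : R -> scalar_field R k :=
  match k return R -> scalar_field R k with
  | RealScalars => fun r => r
  | ComplexScalars => fun r => (r%:C)%C
  end.
Arguments real_scalar {R k} _.
Notation "r %:K" := (real_scalar r) (at level 2, format "r %:K").

Section Scalars.
Variables (R : realType) (k : scalars).
Local Notation K := (scalar_field R k).

Lemma scalar_reD (x y : K) : scalar_re (x + y) = scalar_re x + scalar_re y.
Proof. by case: k x y => //= -[a b] [c d]. Qed.

Lemma scalar_reB (x y : K) : scalar_re (x - y) = scalar_re x - scalar_re y.
Proof. by case: k x y => //= -[a b] [c d]. Qed.

Lemma scalar_re0 : scalar_re (0 : K) = 0.
Proof. by case: k. Qed.

Lemma scalar_re_realM (r : R) (z : K) : scalar_re (r%:K * z) = r * scalar_re z.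
Proof. by case: k z => //= -[a b] /=; rewrite mul0r subr0. Qed.

Lemma real_scalar1B (r : R) : (1 - r)%:K = 1 - r%:K :> K.
Proof. by case: k => //=; rewrite rmorphB rmorph1. Qed.

Lemma real_scalar_le (r s : R) : (r%:K <= s%:K :> K) = (r <= s).
Proof. by case: k => //=; rewrite lecR. Qed.

Lemma real_scalar1 : (1 : R)%:K = 1 :> K.
Proof. by case: k. Qed.

Lemma real_scalar_ge0 (r : R) : (0 <= r%:K :> K) = (0 <= r).
Proof. by case: k => //=; rewrite lecR. Qed.

Lemma normr_scalar_re (z : K) : `|scalar_re z| <= scalar_re `|z|.
Proof.
case: k z => [z|z] //=; have := normc_ge_Re z.
by rewrite lecE /= => /andP[].
Qed.

Lemma le_scalar_re (x y : K) : x <= y -> scalar_re x <= scalar_re y.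
Proof. by case: k x y => //= x y; rewrite lecE => /andP[]. Qed.

Lemma lt_scalar_re (x y : K) : x < y -> scalar_re x < scalar_re y.
Proof. by case: k x y => //= x y; rewrite ltcE => /andP[]. Qed.

Lemma scalar_re_real (r : R) : scalar_re (r%:K : K) = r.
Proof. by case: k. Qed.

Lemma real_scalar_gt0 (r : R) : (0 < r%:K :> K) = (0 < r).
Proof. by case: k => //=; rewrite ltcR. Qed.

Lemma open_scalar_re_gt (c : R) : open [set z : K^o | c < scalar_re z].
Proof.
rewrite openE => z /= cz; apply/nbhs_ballP => /=.
exists (scalar_re z - c)%:K => [|y]; first by rewrite /= real_scalar_gt0 subr_gt0.
rewrite -ball_normE /= => /lt_scalar_re; rewrite scalar_re_real.
have := normr_scalar_re (z - y); rewrite scalar_reB.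
have := ler_norm (scalar_re z - scalar_re y); lra.
Qed.

(** Real parts alone control neighbourhoods in K: the imaginary part of z is the
real part of -i z, so u = -i works over the complex numbers and u = 0 over the
reals. *)
Lemma nbhs_scalar_re : exists u : K,
  forall (O : set K^o) (z0 : K), nbhs (z0 : K^o) O ->
  exists2 e : R, 0 < e &
    forall z, scalar_re (z - z0) ^+ 2 + scalar_re (u * (z - z0)) ^+ 2 < e -> O z.
Proof.
case: k => /=.
  exists 0 => O z0 /nbhs_ballP[e /= e0 eO]; exists (e ^+ 2) => [|z].
    by rewrite exprn_gt0.
  rewrite mul0r expr0n addr0 => ze; apply: eO; rewrite -ball_normE /= distrC.
  by rewrite -(@ltr_pXn2r _ 2) ?nnegrE ?(ltW e0)// real_normK ?num_real.
exists (0 -i* 1)%C => O z0 /nbhs_ballP[e /= e0 eO].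
have [r r0 er] : exists2 r : R, 0 < r & e = (r%:C)%C.
  case: e e0 {eO} => a b; rewrite ltcE /= => /andP[/eqP-> a0].
  by exists a.
exists (r ^+ 2) => [|z zr]; first by rewrite exprn_gt0.
apply: eO; rewrite -ball_normE /= distrC er normc_def ltcR.
rewrite -(@ltr_pXn2r _ 2) ?nnegrE ?(ltW r0) ?sqrtr_ge0// sqr_sqrtr.
  by move: zr; case: (z - z0) => a b /=; rewrite mul0r sub0r mulN1r opprK.
by rewrite addr_ge0 ?sqr_ge0.
Qed.

End Scalars.

(** * Functionals, slices and basic weak neighbourhoods *)

Section Functionals.
Variables (R : realType) (k : scalars).
Local Notation K := (scalar_field R k).
Variable X : normedModType K.
Implicit Types (A : set X) (f g : topological_dual X) (gs : seq (topological_dual X)).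

Lemma dualD f x y : f (x + y) = f x + f y.
Proof. exact: (raddfD (sval f)). Qed.

Lemma dualB f x y : f (x - y) = f x - f y.
Proof. exact: (raddfB (sval f)). Qed.

Lemma dualZ f (l : K) x : f (l *: x) = l * f x.
Proof. exact: (linearZZ (sval f)). Qed.

Lemma scalar_re_dualD f x y : scalar_re (f (x + y)) = scalar_re (f x) + scalar_re (f y).
Proof. by rewrite dualD scalar_reD. Qed.

Lemma scalar_re_dualZ f (r : R) x : scalar_re (f (r%:K *: x)) = r * scalar_re (f x).
Proof. by rewrite dualZ scalar_re_realM. Qed.

Lemma dual_scale f (l : K) : exists g, forall x, g x = l * f x.
Proof.
have cg : continuous (l \*: sval f).
  by move=> x; apply: cvgZr; exact: (svalP f x).
by exists (exist _ (l \*: sval f : {linear X -> K^o}) cg).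
Qed.

Lemma dual_add f g : exists h : topological_dual X, forall x, h x = f x + g x.
Proof.
have ch : continuous (sval f \+ sval g).
  by move=> x; apply: cvgD; [exact: (svalP f x)|exact: (svalP g x)].
by exists (exist _ (sval f \+ sval g : {linear X -> K^o}) ch).
Qed.

Lemma dual_zero : exists h : topological_dual X, forall x, h x = 0.
Proof.
have ch : continuous (\0 : X -> K^o) by exact: cst_continuous.
by exists (exist _ (\0 : {linear X -> K^o}) ch).
Qed.

(** The directions y - z of the semi-inner product below act on X through such
combinations, which is why they define slices. *)
Lemma dual_real_comb gs (c : topological_dual X -> R) : exists h : topological_dual X,
  forall x, scalar_re (h x) = \sum_(g <- gs) c g * scalar_re (g x).
Proof.
elim: gs => [|g gs [h hE]].
  by have [h hE] := dual_zero; exists h => x; rewrite hE big_nil scalar_re0.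
have [g' g'E] := dual_scale g (c g)%:K; have [h' h'E] := dual_add g' h.
by exists h' => x; rewrite h'E g'E scalar_reD scalar_re_realM big_cons hE.
Qed.

Lemma dual_bounded A f : bounded_set A ->
  exists M : R, forall x, A x -> `|scalar_re (f x)| <= M.
Proof.
move=> /= bA; have /linear_bounded_continuous/linear_boundedP := svalP f.
move=> /pinfty_ex_gt0 [r r0 fr].
have /pinfty_ex_gt0 [M M0 AM] := bA.
exists (scalar_re (r * M)) => x Ax; apply: (le_trans (@normr_scalar_re R k (f x))).
apply: le_scalar_re; apply: (le_trans (fr x)); rewrite ler_pM2l//.
exact: AM.
Qed.

(** Boundedness of A makes the supremum in the definition of a slice a genuine
one, so that every half-space meeting A cuts off a slice of positive depth. *)
Lemma is_slice_halfspace A f (c : R) y : bounded_set A -> A y -> c < scalar_re (f y) ->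
  is_slice A [set x | A x /\ c < scalar_re (f x)].
Proof.
move=> bA Ay cy; split; first by exists y.
set s := sup [set scalar_re (f b) | b in A].
have ys : scalar_re (f y) <= s.
  apply: ub_le_sup; last by exists y.
  have [M AM] := dual_bounded f bA; exists M => _ [x Ax <-].
  exact: le_trans (ler_norm _) (AM x Ax).
exists f, (s - c); split; first by rewrite subr_gt0; exact: lt_le_trans cy ys.
by rewrite /slice -/s subKr.
Qed.

Lemma slice_sub A S : is_slice A S -> S `<=` A.
Proof. by case=> _ [f [c [_ ->]]] x []. Qed.

Lemma slice_relatively_weakly_open A S : is_slice A S -> relatively_weakly_open A S.
Proof.
case=> _ [f [c [_ ->]]].
set t := sup [set scalar_re (f b) | b in A] - c.
exists [set x | t < scalar_re (f x)] => //.
rewrite openE => x tx.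
have : @nbhs _ (weak_topology X) x --> (x : weak_topology X) by [].
move/cvg_sup => /(_ f).
apply; apply: (@open_nbhs_nbhs (initial_topology f)); split => //.
exists [set z : K^o | t < scalar_re z] => //; exact: open_scalar_re_gt.
Qed.

(** The semi-inner product of R^n pulled back along the real functionals Re g.
Working with it on X avoids transferring slices and convex combinations between
X and a Euclidean space. *)
Definition sip gs (x y : X) : R := \sum_(g <- gs) scalar_re (g x) * scalar_re (g y).
Local Notation sq gs x := (sip gs x x).

Lemma sipC gs x y : sip gs x y = sip gs y x.
Proof. by apply: eq_bigr => g _; rewrite mulrC. Qed.

Lemma sipDl gs x y z : sip gs (x + y) z = sip gs x z + sip gs y z.
Proof.
by rewrite /sip -big_split; apply: eq_bigr => g _; rewrite scalar_re_dualD mulrDl.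
Qed.

Lemma sipZl gs (r : R) x y : sip gs (r%:K *: x) y = r * sip gs x y.
Proof.
by rewrite /sip mulr_sumr; apply: eq_bigr => g _; rewrite scalar_re_dualZ mulrA.
Qed.

Lemma sipBl gs x y z : sip gs (x - y) z = sip gs x z - sip gs y z.
Proof.
by apply/eqP; rewrite eq_sym subr_eq -sipDl subrK.
Qed.

Lemma sipDr gs x y z : sip gs z (x + y) = sip gs z x + sip gs z y.
Proof. by rewrite sipC sipDl !(sipC gs z). Qed.

Lemma sipBr gs x y z : sip gs z (x - y) = sip gs z x - sip gs z y.
Proof. by rewrite sipC sipBl !(sipC gs z). Qed.

Lemma sipZr gs (r : R) x y : sip gs x (r%:K *: y) = r * sip gs x y.
Proof. by rewrite sipC sipZl sipC. Qed.

Lemma sip_ge0 gs x : 0 <= sq gs x.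
Proof. by apply: sumr_ge0 => g _; rewrite -expr2 sqr_ge0. Qed.

Lemma sip_cat gs hs x y : sip (gs ++ hs) x y = sip gs x y + sip hs x y.
Proof. exact: big_cat. Qed.

Lemma sip_sqD gs x y : sq gs (x + y) <= 2 * sq gs x + 2 * sq gs y.
Proof.
have := sip_ge0 gs (x - y).
rewrite !sipBl !sipBr !sipDl !sipDr (sipC gs y x); lra.
Qed.

Lemma sip_bounded gs A : bounded_set A -> exists M : R, forall x, A x -> sq gs x <= M.
Proof.
move=> bA; elim: gs => [|g gs [M AM]]; first by exists 0 => x _; rewrite /sip big_nil.
have [N AN] := dual_bounded g bA; exists (N ^+ 2 + M) => x Ax.
rewrite /sip big_cons lerD ?AM// -expr2 -real_normK ?num_real//.
by rewrite lerXn2r ?nnegrE ?AN// (le_trans _ (AN x Ax)).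
Qed.

(** The balls of all the semi-norms form a filter at x0: concatenating two
lists of functionals adds the squares, so a ball for the longer list lies in
both given balls. That filter converges to x0 along each functional of the dual,
hence in the weak topology. *)
Lemma weak_nbhs_sip (U : set (weak_topology X)) (x0 : X) : open U -> U x0 ->
  exists gs, exists2 e : R, 0 < e & forall x, sq gs (x - x0) < e -> U x.
Proof.
move=> oU Ux0.
pose F := filter_from [set p : seq (topological_dual X) * R | 0 < p.2]
  (fun p => [set x | sq p.1 (x - x0) < p.2]).
have FF : Filter F.
  apply: filter_from_filter; first by exists ([::], 1) => /=.
  move=> [gs e] [hs d] /= e0 d0; exists (gs ++ hs, Num.min e d) => /=.
    by rewrite lt_min e0.
  move=> x /=; rewrite sip_cat lt_min => /andP[xe xd].
  by split; [apply: le_lt_trans xe|apply: le_lt_trans xd];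
    rewrite ?lerDl ?lerDr sip_ge0.
have : F --> (x0 : weak_topology X).
  apply/cvg_sup => f V /= [_ [[W oW <-] Wx0] WV].
  have [u /(_ W (f x0))] := nbhs_scalar_re R k.
  case; first by apply: open_nbhs_nbhs.
  move=> e e0 eW; have [g gE] := dual_scale f u.
  exists ([:: f; g], e) => //= x xe; apply: WV; apply: eW.
  move: xe; rewrite /= /sip big_cons big_seq1 gE dualB.
  by rewrite -!expr2.
move=> /(_ U) [|[gs e] e0 eU].
  exact: open_nbhs_nbhs.
by exists gs, e => //= x /eU.
Qed.

End Functionals.

(** * Convex sets *)

Section ConvexSets.
Variables (F : numFieldType) (M : lmodType F).
Implicit Types A B : set M.

Lemma convex_setP A : @convex_set F M A <->
  forall x y (l : F), A x -> A y -> 0 <= l -> l <= 1 -> A (l *: x + (1 - l) *: y).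
Proof.
split=> [cA x y l Ax Ay l0 l1|cA x y l /set_mem Ax /set_mem Ay].
  by have /set_mem := cA x y (Itv01 l0 l1) (mem_set Ax) (mem_set Ay).
by apply/mem_set; exact: cA.
Qed.

(** Induction on the number of points: the sum is a convex combination of the
first point and of the sum of the others with renormalized weights. *)
Lemma convex_sum A n (l : 'I_n -> F) (t : 'I_n -> M) : @convex_set F M A ->
  (forall i, 0 <= l i) -> \sum_i l i = 1 -> (forall i, A (t i)) ->
  A (\sum_i l i *: t i).
Proof.
move=> /convex_setP cA; elim: n l t => [|n IH] l t l0 l1 At.
  by move: l1; rewrite big_ord0 => /esym/eqP; rewrite oner_eq0.
move: l1; rewrite !big_ord_recl /= => l1.
have rE : \sum_(i < n) l (lift ord0 i) = 1 - l ord0 by rewrite -l1 addrC addKr.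
have r0 : 0 <= 1 - l ord0 by rewrite -rE sumr_ge0.
have [r_eq0|r_neq0] := eqVneq (1 - l ord0) 0.
  have z i : l (lift ord0 i) = 0.
    apply/eqP; move: rE; rewrite r_eq0 => /eqP.
    by rewrite psumr_eq0 // => /allP/(_ i); rewrite mem_index_enum; exact.
  rewrite big1 => [|i _]; last by rewrite z scale0r.
  by move/eqP: r_eq0; rewrite subr_eq0 => /eqP<-; rewrite scale1r addr0.
have -> : \sum_(i < n) l (lift ord0 i) *: t (lift ord0 i) =
    (1 - l ord0) *: \sum_(i < n) (l (lift ord0 i) / (1 - l ord0)) *: t (lift ord0 i).
  rewrite scaler_sumr; apply: eq_bigr => i _.
  by rewrite scalerA mulrC divfK.
apply: cA => //; last by rewrite -subr_ge0.
apply: IH => // [i|]; first by rewrite divr_ge0.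
by rewrite -mulr_suml rE divff.
Qed.

End ConvexSets.

Section ConvexHull.
Variables (R : realType) (k : scalars).
Local Notation K := (scalar_field R k).
Variable X : normedModType K.
Implicit Types A B S : set X.

Lemma convex_convex_hull B : @convex_set K X (convex_hull B).
Proof.
apply/convex_setP => x y l Bx By l0 l1 C [cC BC].
by move/convex_setP: (cC); apply => //; [exact: Bx|exact: By].
Qed.

Lemma convex_set_real A : @convex_set K X A -> forall x y (s : R), A x -> A y ->
  0 <= s <= 1 -> A (s%:K *: x + (1 - s)%:K *: y).
Proof.
move=> /convex_setP cA x y s Ax Ay /andP[s0 s1]; rewrite real_scalar1B.
by apply: cA; rewrite ?real_scalar_ge0 // -real_scalar1 real_scalar_le.
Qed.

Lemma convex_comb_sub A S :
  @convex_set K X A -> is_convex_comb_of_slices A S -> S `<=` A.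
Proof.
move=> cA [n [l [T [l0 l1 sT ->]]]] _ [t Tt ->].
by apply: convex_sum => // i; exact: slice_sub (Tt i).
Qed.

Lemma convex_comb_nonempty A S : is_convex_comb_of_slices A S -> S !=set0.
Proof.
move=> [n [l [T [l0 l1 sT ->]]]].
have /choice[t Tt] : forall i, exists x, T i x by move=> i; have [] := sT i.
by exists (\sum_i l i *: t i), t.
Qed.

Lemma is_slice_convex_comb A S : is_slice A S -> is_convex_comb_of_slices A S.
Proof.
move=> sS; exists 1%N, (fun=> 1), (fun=> S); split => //.
  by rewrite big_ord_recl big_ord0 addr0.
apply/seteqP; split=> [x Sx|_ [t St ->]].
  by exists (fun=> x) => //; rewrite big_ord_recl big_ord0 scale1r addr0.
by rewrite big_ord_recl big_ord0 scale1r addr0.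
Qed.

(** Mixing two convex combinations of slices puts the two families of weights
side by side, scaled by s and 1 - s. *)
Lemma convex_comb_mix A S1 S2 (s : R) : 0 <= s <= 1 ->
  is_convex_comb_of_slices A S1 -> is_convex_comb_of_slices A S2 ->
  exists S, is_convex_comb_of_slices A S /\
    S `<=` [set s%:K *: x + (1 - s)%:K *: y | x in S1 & y in S2].
Proof.
move=> /andP[s0 s1] [n [l [T [l0 l1 sT ->]]]] [m [h [U [h0 h1 sU ->]]]].
pose c i :=
  match fintype.split i with inl j => s%:K * l j | inr j => (1 - s)%:K * h j end.
pose V i := match fintype.split i with inl j => T j | inr j => U j end.
have cl j : c (lshift m j) = s%:K * l j.
  by rewrite /c -[lshift m j]/(unsplit (inl j)) unsplitK.
have cr j : c (rshift n j) = (1 - s)%:K * h j.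
  by rewrite /c -[rshift n j]/(unsplit (inr j)) unsplitK.
have Vl j : V (lshift m j) = T j.
  by rewrite /V -[lshift m j]/(unsplit (inl j)) unsplitK.
have Vr j : V (rshift n j) = U j.
  by rewrite /V -[rshift n j]/(unsplit (inr j)) unsplitK.
eexists; split.
  exists (n + m)%N, c, V; split => [i||i|]; last by reflexivity.
  - rewrite /c; case: (fintype.split i) => j; apply: mulr_ge0 => //.
      by rewrite real_scalar_ge0.
    by rewrite real_scalar_ge0 subr_ge0.
  - rewrite big_split_ord /=.
    rewrite (eq_bigr _ (fun j _ => cl j)) (eq_bigr _ (fun j _ => cr j)).
    by rewrite -!mulr_sumr l1 h1 !mulr1 real_scalar1B addrC subrK.
  - by rewrite /V; case: (fintype.split i).
move=> _ [t Vt ->]; rewrite big_split_ord /=.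
exists (\sum_i l i *: t (lshift m i)).
  by exists (fun i => t (lshift m i)) => // i; rewrite -Vl.
exists (\sum_i h i *: t (rshift n i)).
  by exists (fun i => t (rshift n i)) => // i; rewrite -Vr.
rewrite !scaler_sumr; congr (_ + _); apply: eq_bigr => i _.
  by rewrite cl scalerA.
by rewrite cr scalerA.
Qed.

End ConvexHull.

(** * Bourgain's lemma *)

Section Bourgain.
Variables (R : realType) (k : scalars).
Local Notation K := (scalar_field R k).
Variable X : normedModType K.
Implicit Types A C : set X.
Variable gs : seq (topological_dual X).
Local Notation dot := (sip gs).
Local Notation sq x := (dot x x).

Lemma sqDZ x y (t : R) : sq (x + t%:K *: y) = sq x + 2 * t * dot x y + t ^+ 2 * sq y.
Proof. rewrite !sipDl !sipDr !sipZl !sipZr (sipC gs y x); ring. Qed.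

Lemma sqB x y : sq (x - y) = sq x - 2 * dot x y + sq y.
Proof. rewrite !sipBl !sipBr (sipC gs y x); ring. Qed.

Lemma sqBC x y : sq (x - y) = sq (y - x).
Proof. by rewrite !sqB (sipC gs y x); ring. Qed.

Lemma sq_convex (s : R) x y : 0 <= s <= 1 ->
  sq (s%:K *: x + (1 - s)%:K *: y) <= s * sq x + (1 - s) * sq y.
Proof.
move=> /andP[s0 s1].
have : 0 <= s * (1 - s) * sq (x - y) by rewrite !mulr_ge0 ?sip_ge0 ?subr_ge0.
rewrite sqB !sipDl !sipDr !sipZl !sipZr (sipC gs y x); lra.
Qed.

(** If p is nearly the point of C nearest to x0, the angle at p between x0 and
any c in C is nearly obtuse: otherwise a short step from p towards c would come
noticeably closer to x0. The step length s = e / 2M balances the second-order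
term s^2 M of that step against the tolerance e^2 / 4M. *)
Lemma nearest_obtuse C x0 p (e M : R) :
  (forall x y (s : R), C x -> C y -> 0 <= s <= 1 -> C (s%:K *: x + (1 - s)%:K *: y)) ->
  0 < e -> e <= M -> C p -> (forall c, C c -> sq (c - p) <= M) ->
  (forall c, C c -> sq (p - x0) <= sq (c - x0) + e ^+ 2 / (4 * M)) ->
  forall c, C c -> dot (c - p) (x0 - p) <= e / 2.
Proof.
move=> cC e0 eM Cp CM near c Cc.
have M0 : 0 < M by exact: lt_le_trans e0 eM.
set s := e / (2 * M).
have s0 : 0 < s by rewrite divr_gt0// mulr_gt0.
have s1 : s <= 1 by rewrite ler_pdivrMr ?mulr_gt0//; lra.
have {near} : sq (p - x0) <= sq (p - x0 + s%:K *: (c - p)) + e ^+ 2 / (4 * M).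
  have -> : p - x0 + s%:K *: (c - p) = (s%:K *: c + (1 - s)%:K *: p) - x0.
    rewrite real_scalar1B scalerBr scalerBl scale1r; rewrite [LHS]addrC !addrA.
    by rewrite -!addrA; congr (_ + _); rewrite addrCA addrA.
  by apply: near; apply: cC => //; rewrite (ltW s0).
rewrite sqDZ.
have sM : s ^+ 2 * sq (c - p) <= s ^+ 2 * M.
  by rewrite ler_wpM2l ?sqr_ge0// CM.
have -> : e ^+ 2 / (4 * M) = s * (e / 2) by rewrite /s; field; lra.
have sME : s ^+ 2 * M = s * (e / 2) by rewrite /s; field; lra.
have -> : dot (p - x0) (c - p) = - dot (c - p) (x0 - p).
  by rewrite sipC !sipBr; ring.
move: sM; rewrite sME => sM H.
rewrite -(ler_pM2l s0); lra.
Qed.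

(** A half-space separating C from x0 is approximated by a ball of large radius.
Starting from a nearly nearest p in C, the centre is moved from p away from x0
by t (x0 - p). Compared with the squared distance to p, the squared distance to
the centre is larger by t^2 |x0 - p|^2 + 2t |x0 - p|^2 for x0 but, by the obtuse
angle at p, by at most t^2 |x0 - p|^2 + t e for the points of C. As the squared
distance to p is at least e for x0 and at most M on C, t = M / e gives the margin
e. *)
Lemma separating_ball C x0 (e M : R) : C !=set0 ->
  (forall x y (s : R), C x -> C y -> 0 <= s <= 1 -> C (s%:K *: x + (1 - s)%:K *: y)) ->
  0 < e -> (forall x y, C x -> C y -> sq (x - y) <= M) ->
  (forall c, C c -> e <= sq (c - x0)) ->
  exists z, forall c, C c -> sq (c - z) + e <= sq (x0 - z).
Proof.
move=> C0 cC e0 CM far.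
(* The step length e / 2M of the obtuse angle lemma has to be at most 1. *)
wlog eM : M CM / e <= M.
  move=> H; apply: (H (Num.max M e)); last by rewrite le_max lexx orbT.
  by move=> x y Cx Cy; rewrite le_max CM.
have M0 : 0 < M by exact: lt_le_trans e0 eM.
pose D := [set sq (c - x0) | c in C].
have infD : has_inf D.
  split; first by case: C0 => c Cc; exists (sq (c - x0)), c.
  by exists e => _ [c Cc <-]; exact: far.
have d0 : 0 < e ^+ 2 / (4 * M) by rewrite divr_gt0 ?mulr_gt0 ?exprn_gt0.
have [_ [p Cp <-] pinf] := inf_adherent d0 infD.
have near c : C c -> sq (p - x0) <= sq (c - x0) + e ^+ 2 / (4 * M).
  move=> Cc; apply: ltW; apply: (lt_le_trans pinf); rewrite lerD2r.
  by apply: ge_inf; [exact: infD.2|exists c].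
have obt := nearest_obtuse cC e0 eM Cp (fun c Cc => CM c p Cc Cp) near.
set t := M / e.
have t0 : 0 < t by rewrite divr_gt0.
exists (p - t%:K *: (x0 - p)) => c Cc.
have -> : c - (p - t%:K *: (x0 - p)) = (c - p) + t%:K *: (x0 - p).
  by rewrite opprB addrA addrAC.
have -> : x0 - (p - t%:K *: (x0 - p)) = (x0 - p) + t%:K *: (x0 - p).
  by rewrite opprB addrA addrAC.
rewrite !sqDZ.
have H1 := CM c p Cc Cp.
have H2 : e <= sq (x0 - p) by rewrite sqBC far.
have H3 : 2 * t * dot (c - p) (x0 - p) <= t * e.
  have := obt c Cc; rewrite -(ler_pM2l t0); lra.
have H4 : t * e = M by rewrite /t divfK// gt_eqF.
have H5 : t * e <= t * sq (x0 - p) by rewrite ler_pM2l.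
lra.
Qed.

(** For x in the slice { dot x (y - z) > dot y (y - z) - e/4 } the identity
|x - y|^2 = |x - z|^2 + |y - z|^2 - 2 dot (x - z) (y - z) bounds |x - y|^2 by
|x - z|^2 - |y - z|^2 + e/2, which is less than e because y is nearly farthest
from z. *)
Lemma far_point_slice A z (e : R) : bounded_set A -> A !=set0 -> 0 < e ->
  exists y, [/\ A y, forall x, A x -> sq (x - z) < sq (y - z) + e &
    exists S, is_slice A S /\ forall x, S x -> sq (x - y) < e].
Proof.
move=> bA A0 e0; have [M AM] := sip_bounded gs bA.
pose D := [set sq (x - z) | x in A].
have supD : has_sup D.
  split; first by case: A0 => x Ax; exists (sq (x - z)), x.
  exists (2 * M + 2 * sq z) => _ [x Ax <-].
  have := AM x Ax; have := sip_ge0 gs (x + z); rewrite sqB.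
  rewrite !sipDl !sipDr (sipC gs z x); lra.
have e20 : 0 < e / 2 by rewrite divr_gt0.
have [_ [y Ay <-] ysup] := sup_adherent e20 supD.
have far x : A x -> sq (x - z) < sq (y - z) + e / 2.
  move=> Ax; have : sq (x - z) <= sup D by apply: ub_le_sup; [exact: supD.2|exists x].
  lra.
exists y; split=> //; first by move=> x /far; lra.
have [f fE] := dual_real_comb gs (fun g => scalar_re (g (y - z))).
have {}fE x : scalar_re (f x) = dot x (y - z).
  by rewrite fE; apply: eq_bigr => g _; rewrite mulrC.
exists [set x | A x /\ dot y (y - z) - e / 4 < scalar_re (f x)]; split.
  by apply: (is_slice_halfspace bA Ay); rewrite fE; lra.
move=> x [Ax]; rewrite fE => xf; have := far x Ax.
rewrite !sqB; move: xf; rewrite !sipBr; lra.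
Qed.

(** The set C of centres of small convex combinations of slices is convex and
contains points of A nearly farthest from any z. Hence no ball can contain C and
miss a point x0 of A by a fixed margin, and x0 is arbitrarily close to C. *)
Lemma bourgain_sip A x0 (e : R) : bounded_set A -> @convex_set K X A -> A x0 -> 0 < e ->
  exists S, is_convex_comb_of_slices A S /\ forall x, S x -> sq (x - x0) < e.
Proof.
move=> bA cA Ax0 e0; have e40 : 0 < e / 4 by rewrite divr_gt0.
pose C := [set c | A c /\
  exists S, is_convex_comb_of_slices A S /\ forall x, S x -> sq (x - c) < e / 4].
have cC x y (s : R) : C x -> C y -> 0 <= s <= 1 -> C (s%:K *: x + (1 - s)%:K *: y).
  move=> [Ax [S [sS Sx]]] [Ay [T [sT Ty]]] s01.
  split; first exact: convex_set_real.
  have [V [sV VST]] := convex_comb_mix s01 sS sT.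
  exists V; split=> // _ /VST[u Su [v Tv <-]].
  have -> : s%:K *: u + (1 - s)%:K *: v - (s%:K *: x + (1 - s)%:K *: y) =
      s%:K *: (u - x) + (1 - s)%:K *: (v - y).
    by rewrite !scalerBr opprD addrACA.
  apply: le_lt_trans (sq_convex _ _ s01) _.
  have : Num.max (sq (u - x)) (sq (v - y)) < e / 4 by rewrite gt_max Sx// Ty.
  apply: le_lt_trans; set m := Num.max _ _; case/andP: s01 => s0 s1.
  have : 0 <= s * (m - sq (u - x)) by rewrite mulr_ge0// subr_ge0 le_max lexx.
  have : 0 <= (1 - s) * (m - sq (v - y)).
    by rewrite mulr_ge0 ?subr_ge0// le_max lexx orbT.
  lra.
have farC z : exists y, C y /\ forall x, A x -> sq (x - z) < sq (y - z) + e / 4.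
  have [|y [Ay far [S [sS Sy]]]] := far_point_slice z bA _ e40; first by exists x0.
  exists y; split=> //; split=> //; exists S; split=> //.
  exact: is_slice_convex_comb.
have [c [[Ac [S [sS Sc]]] cx0]] : exists c, C c /\ sq (c - x0) < e / 4.
  apply: contrapT => far.
  have [M AM] := sip_bounded gs bA.
  have [|x y Cx Cy|c Cc|z zP] := @separating_ball C x0 (e / 4) (4 * M) _ cC e40.
  - by have [y [Cy _]] := farC x0; exists y.
  - have := AM x Cx.1; have := AM y Cy.1; have := sip_ge0 gs (x + y); rewrite sqB.
    rewrite !sipDl !sipDr (sipC gs y x); lra.
  - by rewrite leNgt; apply/negP => cx0; apply: far; exists c.
  have [y [Cy /(_ x0 Ax0)]] := farC z; have := zP y Cy; lra.
exists S; split=> // x Sx; have := sip_sqD gs (x - c) (c - x0).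
by rewrite subrKA; have := Sc x Sx; lra.
Qed.

End Bourgain.

Lemma bourgain (R : realType) (k : scalars) (X : normedModType (scalar_field R k))
    (A W : set X) : bounded_set A -> convex_set A -> W !=set0 ->
  relatively_weakly_open A W ->
  exists S, is_convex_comb_of_slices A S /\ S `<=` W.
Proof.
move=> bA cA W0 [U oU WE]; move: W0; rewrite WE => -[x0 [Ax0 Ux0]].
have [gs [e e0 eU]] := weak_nbhs_sip oU Ux0.
have [S [sS Sx0]] := bourgain_sip gs bA cA Ax0 e0.
exists S; split=> // x Sx; split; first exact: convex_comb_sub sS _ Sx.
exact/eU/Sx0.
Qed.

(** * Determining sequences *)

Section Determining.
Variables (R : realType) (k : scalars).
Local Notation K := (scalar_field R k).
Variable X : normedModType K.
Implicit Types A : set X.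

Lemma determining_shrink A a (V W : nat -> set X) : determining A a V ->
  (forall n, W n !=set0 /\ W n `<=` V n) -> determining A a W.
Proof.
move=> [VA Va] WV; split=> [n|B BA BW].
  by have [W0 WVn] := WV n; split=> // x /WVn; exact: (VA n).2.
apply: Va => // n; have [x [Bx Wx]] := BW n.
by exists x; split=> //; exact: (WV n).2.
Qed.

Lemma determining_slices A a (V : nat -> set X) : @convex_set K X A ->
  (forall n, is_convex_comb_of_slices A (V n)) -> determining A a V ->
  exists T, (forall n, is_slice A (T n)) /\ determining A a T.
Proof.
move=> cA sV [VA Va].
(* The number of slices varies with n, so the choice is made in a dependent sum;
   the slices are then indexed by the countable type of pairs (n, i < m_n). *)
have /choice[F FP] : forall n, exists F : {m & (('I_m -> K) * ('I_m -> set X))%type},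
    let l := (projT2 F).1 in let T := (projT2 F).2 in
    [/\ forall i, 0 <= l i, \sum_i l i = 1, forall i, is_slice A (T i) &
        V n = [set x | exists2 t : _ -> X,
                 forall i, T i (t i) & x = \sum_i l i *: t i]].
  by move=> n; have [m [l [T lT]]] := sV n; exists (existT _ m (l, T)).
pose sl (j : {n & 'I_(projT1 (F n))}) := (projT2 (F (tag j))).2 (tagged j).
have [j0] : inhabited {n & 'I_(projT1 (F n))}.
  (* An empty sum of weights would be 0, not 1, so there is at least one slice;
     it fills the positions that encode no pair. *)
  have [_ l1 _ _] := FP 0%N.
  case: (pickP (mem 'I_(projT1 (F 0%N)))) => [i _|none].
    by constructor; exists 0%N.
  by move/eqP: l1; rewrite big_pred0 ?(eq_sym 0) ?oner_eq0.
pose T n := sl (odflt j0 (unpickle n)).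
have sT n : is_slice A (T n).
  by rewrite /T /sl; move: (odflt _ _) => [m i]; have [_ _ + _] := FP m; exact.
exists T; split=> //; split=> [n|B BA BT].
  by split; [have [] := sT n|exact: slice_sub].
suff -> : convex_hull B = convex_hull (convex_hull B).
  apply: Va => [|n].
    exact: smallest_sub.
  have [l0 l1 _ ->] := FP n.
  have /choice[t tP] : forall i, exists x, B x /\ (projT2 (F n)).2 i x.
    move=> i; have [x [Bx]] := BT (pickle (Tagged (fun n => 'I_(projT1 (F n))) i)).
    by rewrite /T pickleK /= => ?; exists x.
  exists (\sum_i (projT2 (F n)).1 i *: t i); split.
    apply: convex_sum => //; first exact: convex_convex_hull.
    by move=> i; apply: sub_gen_smallest; exact: (tP i).1.
  by exists t => // i; exact: (tP i).2.
by rewrite [RHS]smallest_id//; exact: convex_convex_hull.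
Qed.

End Determining.

Unset Implicit Arguments.

Theorem proposition2p13 (R : realType) (k : scalars)
    (X : completeNormedModType (scalar_field R k)) (A : set X) (a : X)
    (bA : bounded_set A) (cA : convex_set A) (Aa : A a) :
  [<-> SCD A a;
       exists V : nat -> set X,
         (forall n, V n !=set0 /\ relatively_weakly_open A (V n)) /\
         determining A a V;
       exists V : nat -> set X,
         (forall n, is_convex_comb_of_slices A (V n)) /\ determining A a V].
Proof.
split; [|split].
- move=> [_ [V [sV dV]]]; exists V; split=> // n; split; first by have [] := sV n.
  exact: slice_relatively_weakly_open.
- move=> [V [wV dV]].
  have /choice[S SP] : forall n, exists S, is_convex_comb_of_slices A S /\ S `<=` V n.
    by move=> n; have [V0 oV] := wV n; exact: bourgain.
  exists S; split=> [n|]; first exact: (SP n).1.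
  apply: (determining_shrink dV) => n; split; last exact: (SP n).2.
  exact: convex_comb_nonempty (SP n).1.
- by move=> [V [sV dV]]; split=> //; exact: determining_slices dV.
Qed.
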